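(* Let $\alpha=\alpha(n)$ be a function with $\alpha(n)\big/\big(\log n/n\big)^{1/4}\to\infty$ as $n\to\infty$. For each $n$, let $H=H_n$ be a graph on vertex set $[n]$ with minimum degree $\delta(H)\geq \alpha n$. Then asymptotically almost surely $H\cup G_{n,2}$ is pancyclic, i.e., $\mathbb{P}[H_n\cup G_{n,2}\text{ is pancyclic}]\to 1$ as $n\to\infty$.
   Context: For $d\in\mathbb{N}$, $G_{n,d}$ denotes a graph chosen uniformly at random from all (simple) $d$-regular graphs on vertex set $[n]=\{1,\dots,n\}$ (with $nd$ even). The union $H\cup G$ of two graphs on the same vertex set $[n]$ is the graph on $[n]$ whose edge set is $E(H)\cup E(G)$. A graph on $n$ vertices is pancyclic if it contains a cycle of length $k$ for every $3\leq k\leq n$. An event holds asymptotically almost surely (a.a.s.) if its probability tends to $1$ as $n\to\infty$. *)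

(* Defs.v *)
From HB Require Import structures.
From mathcomp Require Import all_boot all_order all_algebra.
From mathcomp Require Import all_classical all_reals all_analysis.

Set Implicit Arguments.
Unset Strict Implicit.
Unset Printing Implicit Defensive.

Import Order.TTheory GRing.Theory Num.Theory.
Import numFieldNormedType.Exports.

(* The vertex set {1, ..., n} is represented by 'I_n. *)
Definition simple_edges (n : nat) (E : {set {set 'I_n}}) : bool :=
  [forall e in E, #|e| == 2].

Record sgraph (n : nat) := SGraph {
  edges :> {set {set 'I_n}};
  edgesP : simple_edges edges }.

HB.instance Definition _ (n : nat) := [isSub for @edges n].
HB.instance Definition _ (n : nat) := [Finite of sgraph n by <:].

Section Graph.
Variable n : nat.
Implicit Types G H : sgraph n.

Definition adj G : rel 'I_n := fun x y => [set x; y]%SET \in edges G.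

Definition degree G (v : 'I_n) : nat := #|[set e in edges G | v \in e]%SET|.

(* The default value n is irrelevant for n > 0, since every degree is < n. *)
Definition min_degree G : nat := \big[minn/n]_(v : 'I_n) degree G v.

Definition gregular (d : nat) G : bool := [forall v, degree G v == d].

Lemma gunion_subproof G H : simple_edges (edges G :|: edges H).
Proof.
apply/'forall_implyP => e; rewrite inE => /orP[] eE.
- exact: (forall_inP (edgesP G)).
- exact: (forall_inP (edgesP H)).
Qed.

Definition gunion G H : sgraph n := SGraph (gunion_subproof G H).

(* Meaningful for k >= 3: a sequence of k distinct vertices that are
   cyclically adjacent. *)
Definition has_cycle (k : nat) G : bool :=
  [exists c : k.-tuple 'I_n, ucycleb (adj G) c].

Definition pancyclic G : bool :=
  [forall k : 'I_n.+1, (3 <= k) ==> has_cycle k G].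

End Graph.

Definition regular_graphs (n d : nat) : {set sgraph n} :=
  [set G : sgraph n | gregular d G]%SET.

(* Probability of A for a uniformly random element of S; it is 0 if S is
   empty. *)
Definition unif_prob (R : realType) (T : finType) (S : {set T})
    (A : pred T) : R :=
  (#|[set x in S | A x]%SET|%:R / #|S|%:R)%R.

(* Main.v *)
Require Import Defs.
From mathcomp Require Import all_boot all_order all_algebra.
From mathcomp Require Import all_classical all_reals all_analysis.
From mathcomp Require Import fingroup perm zify.
Import Order.TTheory GRing.Theory Num.Theory.
Import numFieldNormedType.Exports.

Set Implicit Arguments.
Unset Strict Implicit.
Unset Printing Implicit Defensive.

(* A uniform 2-regular graph is a uniform relabeling of a 2-regular graph drawn
   from the same distribution, so it suffices to bound, for a fixed [G] with few
   cycles, the proportion of relabelings [w] for which [H] together with [w G]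
   is not pancyclic.

   Few cycles: orienting the cycles embeds the 2-regular graphs into the
   permutations, where the sum of [2 ^ (number of cycles)] is [(n + 1)!], while
   relabelings of one Hamilton cycle already give at least [n! / n ^ 2] graphs.
   So with high probability [G] has at most [t] cycles, with [t] close to
   [n ^ (1/8)].

   Relabeling: the longest cycle of [G] contains [t + 1] disjoint blocks of
   consecutive vertices.  With high probability, for all [x] and [y] every block
   has consecutive vertices [z], [z'] with [z] an [H]-neighbour of [x] and [z']
   one of [y]: revealing the labels of disjoint edges of the block one at a
   time, each of them succeeds with probability at least about
   [(d / (2 n)) ^ 2], where [d] is the minimum degree of [H].

   Rerouting: any path [x, ..., y] can then be inserted between such [z] and
   [z'].  Inserting the other cycles, or parts of them, into the blocks of the
   longest one gives paths of every length, and a rotation at the first block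
   closes them into cycles; short cycles are closed by one edge of that block. *)

(** * Permutations with many cycles *)

Section CycleCount.
Variable T : finType.

Lemma card_permT : #|{: {perm T}}| = #|T| `!.
Proof.
rewrite -cardsT -card_perm; apply: eq_card => w; rewrite inE; symmetry.
by apply/fintype.subsetP => x _; rewrite inE.
Qed.

(* Every permutation of [a |: A] is [tperm a b * s] with [s] a permutation of
   [A]; the transposition joins the fixed point [a] to the cycle of [b]. *)
Lemma sum_exp2_porbits (A : {set T}) :
  (\sum_(s : {perm T} | perm_on A s) 2 ^ #|porbits s|) * 2 ^ #|A|
    <= 2 ^ #|T| * (#|A|.+1)`!.
Proof.
elim: {A}_.+1 {-2}A (ltnSn #|A|) => // k IH A; rewrite ltnS => cA.
(* Fixed points outside [A] count as orbits too; the powers of 2 on the two sides account for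
   them. *)
have [->|/set0Pn[a aA]] := eqVneq A finset.set0.
  rewrite cards0 !muln1 (big_pred1 (1%g : {perm T})) => [|s].
    by rewrite leq_exp2l // leq_imset_card.
  apply/idP/eqP => [s0|->]; last exact: perm_on1.
  by apply: perm_on_id s0 _; rewrite cards0.
pose A' := A :\ a.
have cAA' : #|A| = #|A'|.+1 by rewrite (cardsD1 a) aA.
have {IH} := IH A' _; rewrite -cAA' => /(_ cA) IH.
have step (s : {perm T}) b : perm_on A' s -> b \in A' ->
   2 ^ #|porbits (tperm a b * s)%g| * 2 = 2 ^ #|porbits s|.
  move=> sA'; rewrite 2!inE => /andP[ba bA].
  have sa : s a = a by apply: out_perm sA' _; rewrite !inE eqxx.
  have anb : a \notin porbit s b.
    rewrite porbit_sym; apply/porbitP => -[i]; rewrite permX.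
    by rewrite iter_fix // => /eqP; rewrite (negPf ba).
  have := porbits_mul_tperm s a b; rewrite anb eq_sym ba /= => h.
  by rewrite mulnC -expnS; congr (_ ^ _); lia.
have le : (\sum_(s : {perm T} | perm_on A s) 2 ^ #|porbits s|) * 2 <=
   (\sum_(s : {perm T} | perm_on A' s) 2 ^ #|porbits s|) * #|A|.+1.
  rewrite (partition_big (fun s : {perm T} => s^-1%g a) (mem A)) /=; last first.
    by move=> s sA; rewrite perm_closed // perm_onV.
  apply: leq_trans (_ : (\sum_(b in A) \sum_(s : {perm T} | perm_on A' s)
      2 ^ #|porbits (tperm a b * s)%g|) * 2 <= _).
    rewrite leq_mul2r /=; apply: leq_sum => b bA.
    rewrite (reindex_inj (mulgI (tperm a b))) /=.
    rewrite big_mkcond [leqRHS]big_mkcond; apply: leq_sum => s _ /=.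
    case: ifP => // /andP[sA /eqP sb]; rewrite ifT //.
    have sa : s a = a.
      by rewrite -[RHS](permKV (tperm a b * s)%g) sb permM tpermR.
    apply/fintype.subsetP => x; rewrite !inE => sx.
    have -> /= : x != a by apply: contraNneq sx => ->; rewrite sa.
    apply: contraNT sx => xA; have xb : x != b by apply: contraNneq xA => ->.
    have xa : x != a by apply: contraNneq xA => ->.
    by have := out_perm sA xA; rewrite permM tpermD 1?eq_sym // => ->.
  rewrite (bigD1 a) //= tperm1 mulnDl.
  under [X in X * 2 + _]eq_bigr do rewrite mul1g.
  (* After doubling, [b = a] keeps [a] fixed and contributes the old sum twice; by [step], each of
     the [#|A'|] other choices contributes it once. *)
  have -> : #|A|.+1 = 2 + #|A'| by rewrite cAA'.
  rewrite [leqRHS]mulnDr leq_add2l (eq_bigl (mem A')); last first.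
    by move=> b; rewrite !inE andbC.
  rewrite big_distrl /= mulnC -sum_nat_const; apply: leq_sum => b bA'.
  by rewrite big_distrl /=; apply: leq_sum => s sA'; rewrite step.
rewrite [in 2 ^ _]cAA' expnS mulnA factS.
apply: leq_trans (leq_mul le (leqnn _)) _.
by rewrite mulnAC [leqRHS]mulnCA [leqRHS]mulnC leq_mul2r IH orbT.
Qed.

(** Markov's inequality for [2 ^ #|porbits s|], with [A] the whole type. *)
Lemma card_many_porbits t :
  #|[set s : {perm T} | t <= #|porbits s|]%SET| * 2 ^ t <= (#|T|.+1)`!.
Proof.
have := sum_exp2_porbits [set: T]%SET.
rewrite cardsT [leqRHS]mulnC leq_pmul2r ?expn_gt0 //.
apply: leq_trans; rewrite -sum_nat_const.
rewrite big_mkcond [leqRHS]big_mkcond; apply: leq_sum => s _ /=.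
have -> : perm_on [set: T]%SET s by apply/fintype.subsetP => x _; rewrite inE.
by rewrite inE; case: ifP => // ts; rewrite leq_pexp2l.
Qed.
End CycleCount.

(** * Orienting a 2-regular graph *)

Section Orientation.
Variables (T : finType) (e : rel T).
Hypotheses (e_sym : symmetric e) (e_irr : irreflexive e).
Hypothesis e_two : forall v, exists a b, a != b /\ e v =1 pred2 a b.

Let other x y := odflt x [pick z | e y z && (z != x)].

Let otherP x y : e x y -> e y (other x y) /\ other x y != x.
Proof.
move=> xy; rewrite /other; case: pickP => [z /andP[] //|none].
have [a [b [ab eab]]] := e_two y.
have := none a; have := none b; rewrite !eab /= !eqxx ?orbT /=.
by move=> /negbFE/eqP bx /negbFE/eqP ax; rewrite ax bx eqxx in ab.
Qed.

Let other_uniq x y z : e x y -> e y z -> z != x -> z = other x y.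
Proof.
move=> xy yz zx; have := otherP xy; move: (other x y) => o [yo ox].
have [a [b [ab eab]]] := e_two y.
move: xy yz yo; rewrite e_sym !eab /= => xy yz yo.
move: zx ox; case/orP: xy => /eqP ->; case/orP: yz => /eqP ->;
  by case/orP: yo => /eqP ->; rewrite ?eqxx.
Qed.

Let rev (d : T * T) := (d.2, d.1).

(* Ordered pairs of adjacent vertices are permuted by walking along cycles. *)
Let next (d : T * T) := if e d.1 d.2 then (d.2, other d.1 d.2) else d.

Let next_dart d : e d.1 d.2 -> e (next d).1 (next d).2.
Proof. by rewrite /next => xy; rewrite xy /=; case: (otherP xy). Qed.

(** Reversal conjugates [next] to its inverse, so walks can be traced backwards. *)
Let next_rev d : next (rev (next d)) = rev d.
Proof.
case: d => x y; rewrite {2}/next /=; case: ifP => [xy|xy]; last first.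
  by rewrite /next /= e_sym xy.
have [yo ox] := otherP xy; rewrite /next /rev /= e_sym yo.
congr (_, _); symmetry; apply: other_uniq; rewrite 1?eq_sym // e_sym //.
Qed.

Let next_inj : injective next.
Proof.
apply: (@can_inj _ _ _ (fun d => rev (next (rev d)))) => d.
by rewrite next_rev; case: d.
Qed.

(** Cancelling one step at each end of a walk from [d] to [rev d] leaves a walk from [next d] to its
    own reverse, two steps shorter. Length 0 would give a loop, length 1 an immediate turn back. *)
Let not_rev i d : e d.1 d.2 -> iter i next d <> rev d.
Proof.
elim: i {-2}i (leqnn i) d => [|k IH] [|[|i]] ik d dd //=.
- by case: d dd => x y /= xy [exy _]; rewrite exy e_irr in xy.
- by case: d dd => x y /= xy [exy _]; rewrite exy e_irr in xy.
- case: d dd => x y /= xy; rewrite /next /= xy => -[oy].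
  by have [_] := otherP xy; rewrite oy eqxx.
rewrite -next_rev => /next_inj; rewrite -iterS iterSr.
by apply: IH; [lia | apply: next_dart].
Qed.

(* A cycle is traversed by two orbits of [next], exchanged by [rev]; the one
   whose root has the smaller rank is kept. *)
Let forward d := e d.1 d.2 &&
  (enum_rank (froot next d) < enum_rank (froot next (rev d))).

Let root_next d : froot next (next d) = froot next d.
Proof.
apply/eqP; rewrite (root_connect (fconnect_sym next_inj)).
by rewrite (fconnect_sym next_inj) fconnect1.
Qed.

Let forward_next d : e d.1 d.2 -> forward (next d) = forward d.
Proof.
move=> dd; rewrite /forward next_dart // dd root_next /=.
by rewrite -[froot next (rev (next d))]root_next next_rev.
Qed.

Let forward_rev x y : e x y -> forward (y, x) = ~~ forward (x, y).
Proof.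
move=> xy; rewrite /forward /= e_sym xy /= -leqNgt [RHS]leq_eqVlt.
case: eqP => [/val_inj/enum_rank_inj/eqP|//].
rewrite (root_connect (fconnect_sym next_inj)) => /iter_findex.
by move/not_rev => []; rewrite /= e_sym.
Qed.

Let forward_turn x y z : e x y -> e y z -> z != x ->
  forward (y, z) = forward (x, y).
Proof.
move=> xy yz zx; rewrite -(@forward_next (x, y)) //.
by rewrite /next /= xy (other_uniq xy yz zx).
Qed.

Let forward_e x y : forward (x, y) -> e x y. Proof. by case/andP. Qed.

Let forward_inj x y y' : forward (x, y) -> forward (x, y') -> y = y'.
Proof.
move=> xy xy'; apply/eqP/negPn/negP => yy'.
have := @forward_turn y x y' _ (forward_e xy') _; rewrite e_sym forward_e //.
move=> /(_ erefl); rewrite eq_sym yy' xy' => /(_ erefl).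
by rewrite forward_rev ?xy // forward_e.
Qed.

(** At each vertex a forward pair enters along one edge and leaves along the other, so following the
    outgoing one is a well-defined injection. *)
Lemma orientation : exists s : {perm T},
  forall x y, e x y = (s x == y) || (s y == x).
Proof.
pose f x := odflt x [pick y | forward (x, y)].
have fP x : forward (x, f x).
  rewrite /f; case: pickP => //= none.
  have [a [b [ab eab]]] := e_two x.
  have xa : e x a by rewrite eab /= eqxx.
  have xb : e x b by rewrite eab /= eqxx orbT.
  have := none b; rewrite (@forward_turn a) //; last by rewrite eq_sym.
    by rewrite forward_rev // none.
  by rewrite e_sym.
have f_inj : injective f.
  move=> x x' fx; apply/eqP/negPn/negP => xx'.
  have fx' := fP x'; rewrite -fx in fx'.
  have := @forward_turn x (f x) x' (forward_e (fP x)).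
  rewrite e_sym forward_e // eq_sym xx' fP => /(_ erefl erefl).
  by rewrite forward_rev ?fx' // forward_e.
exists (perm f_inj) => x y; rewrite !permE.
apply/idP/orP => [xy|[] /eqP <-]; last 2 first.
- exact: forward_e.
- by rewrite e_sym forward_e.
case: (boolP (forward (x, y))) => [xy'|nxy].
  by left; rewrite (forward_inj (fP x) xy').
by right; rewrite (@forward_inj y (f y) x) // forward_rev.
Qed.
End Orientation.

(** * Cutting the cycles of a permutation open into paths *)

Section Forest.
Variables (T : finType) (s : {perm T}).

(** Each cycle is read off once, starting from its root. Uniqueness and total size together say that
    the paths partition [T]. *)
Lemma orbit_forest : exists ps : seq (seq T),
  [/\ size ps <= #|porbits s|, all (sorted (frel s)) ps, uniq (flatten ps) &
      size (flatten ps) = #|T|].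
Proof.
have csym := fconnect_sym (@perm_inj _ s).
pose rs := enum (froots s).
have rootsE x : x \in rs -> froot s x = x by rewrite mem_enum => /eqP.
have u : uniq (flatten [seq orbit s x | x <- rs]).
  have : uniq rs := enum_uniq _.
  elim: rs rootsE => //= x r IH rootsE /andP[xr ur].
  rewrite cat_uniq orbit_uniq IH //=; last first.
    by move=> y yr; apply: rootsE; rewrite inE yr orbT.
  rewrite andbT; apply/hasPn => z /flatten_mapP[y yr].
  rewrite -!fconnect_orbit => yz; apply: contra xr => xz.
  rewrite -(rootsE x) ?mem_head //.
  rewrite (fingraph.rootP csym xz) -(fingraph.rootP csym yz).
  by rewrite rootsE // inE yr orbT.
exists [seq orbit s x | x <- rs]; split=> //.
- rewrite size_map -cardE -(card_in_imset (f := porbit s)).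
    apply/subset_leq_card/fintype.subsetP => P /imsetP[x _ ->].
    exact: imset_f.
  move=> x y xr yr /eqP; rewrite eq_porbit_mem porbit_sym => /porbitP[i].
  rewrite permX => xy.
  rewrite -(eqP (xr : _ == _)) -(eqP (yr : _ == _)).
  by apply/(fingraph.rootP csym); rewrite xy fconnect_iter.
- apply/allP => p /mapP[x _ ->]; rewrite /orbit.
  by case: (fingraph.order s x) => //= k; apply: fpath_traject.
rewrite -(card_uniqP u); apply: eq_card => x; rewrite [RHS]inE.
apply/flatten_mapP; exists (froot s x).
  by rewrite mem_enum; apply: roots_root.
by rewrite -fconnect_orbit csym connect_root.
Qed.
End Forest.

(** * Random bijections hitting prescribed sets *)

Section Switching.
Variable T : finType.
Implicit Types (F : {set {perm T}}) (X Y Z : {set T}).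

(** Membership in [F] is decided by the labels on [Z], the part of the labeling revealed so far. *)
Definition depends_on F Z :=
  forall w w' : {perm T}, w \in F -> {in Z, w =1 w'} -> w' \in F.

(* Exchanging the values at [u] and at some [a] outside [Z] with [w a] in [X]. *)
Lemma card_hit F Z X u : depends_on F Z -> u \notin Z ->
  (#|X| - #|Z|) * #|F| <= #|T| * #|[set w in F | w u \in X]%SET|.
Proof.
move=> depF uZ.
have count_a a : a \notin Z -> #|[set w in F | w a \in X]%SET| <=
                                #|[set w in F | w u \in X]%SET|.
  move=> aZ; rewrite -(card_imset _ (mulgI (tperm u a))).
  apply/subset_leq_card/fintype.subsetP => w' /imsetP[w].
  rewrite !inE => /andP[wF wa] ->; rewrite permM tpermL wa andbT.
  apply: (depF w) => // z zZ; rewrite permM tpermD //.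
  - by apply: contraNneq uZ => ->.
  - by apply: contraNneq aZ => ->.
(* Double counting of the pairs [(w, a)] with [a] outside [Z] and [w a] in [X]: [count_a] bounds
   them for each [a], and each [w] in [F] has at least [#|X| - #|Z|] of them. *)
apply: leq_trans (_ : \sum_(a : T | a \notin Z)
   #|[set w in F | w a \in X]%SET| <= _); last first.
  rewrite -sum_nat_const; apply: leq_trans (_ : \sum_(a : T | a \notin Z)
      #|[set w in F | w u \in X]%SET| <= _); first exact: leq_sum.
  by rewrite [leqRHS](bigID (fun a => a \notin Z)) /= leq_addr.
under eq_bigr do rewrite -sum1_card.
under eq_bigr do under eq_bigl do rewrite inE.
rewrite (exchange_big_dep (mem F)) /=; last by move=> a w _ /andP[].
rewrite mulnC -sum_nat_const; apply: leq_sum => w wF.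
rewrite leq_subLR -(card_imset (mem X) (@perm_inj _ w^-1%g)).
rewrite -[leqRHS]addnC.
have sub : w^-1%g @: X \subset (w^-1%g @: X :\: Z) :|: Z.
  by apply/fintype.subsetP => x; rewrite !inE => ->; case: (x \in Z).
apply: leq_trans (subset_leq_card sub) _.
apply: leq_trans (leq_card_setU _ _) _; rewrite leq_add2r sum1_card.
apply/subset_leq_card/fintype.subsetP => a; rewrite !inE.
move=> /andP[aZ /imsetP[x xX ax]].
by rewrite unfold_in /= aZ wF ax permKV xX.
Qed.

(** Two applications of [card_hit]; once [u] is revealed, the event depends on one more point,
    whence [#|Z|.+1]. *)
Lemma card_hit2 F Z X Y d u v : depends_on F Z ->
    u \notin Z -> v \notin Z -> u != v -> d <= #|X| -> d <= #|Y| ->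
  (d - #|Z|.+1) ^ 2 * #|F|
    <= #|T| ^ 2 * #|[set w in F | (w u \in X) && (w v \in Y)]%SET|.
Proof.
move=> depF uZ vZ uv dX dY.
pose F1 := [set w in F | w u \in X]%SET.
have depF1 : depends_on F1 (u |: Z).
  move=> w w'; rewrite !inE => /andP[wF wu] eqw.
  rewrite -(eqw u) ?inE ?eqxx // wu andbT; apply: (depF w) => // z zZ.
  by apply: eqw; rewrite inE zZ orbT.
have h1 := card_hit X depF uZ.
have vZ' : v \notin u |: Z by rewrite !inE negb_or eq_sym uv.
have := card_hit Y depF1 vZ'; rewrite cardsU1 uZ add1n => h2.
have -> : [set w in F | (w u \in X) && (w v \in Y)]%SET
          = [set w in F1 | w v \in Y]%SET.
  by apply/setP => w; rewrite !inE andbA.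
apply: leq_trans (_ : #|T| * ((#|Y| - #|Z|.+1) * #|F1|) <= _); last first.
  by rewrite -mulnA leq_mul2l h2 orbT.
rewrite mulnCA -mulnA; apply: leq_mul; first exact: leq_sub2r.
apply: leq_trans h1; apply: leq_mul => //.
by apply: leq_trans (leq_sub2r _ dX); apply: leq_sub2l.
Qed.

Definition unpair (l : seq (T * T)) : seq T :=
  flatten [seq [:: p.1; p.2] | p <- l].

Lemma size_unpair l : size (unpair l) = (size l).*2.
Proof. by elim: l => //= p l ->. Qed.

Definition missing X Y (l : seq (T * T)) : {set {perm T}} :=
  [set w : {perm T} | all (fun p => ~~ ((w p.1 \in X) && (w p.2 \in Y))) l]%SET.

(** Given that all pairs of the tail fail, the head pair succeeds with proportion at least
    [((d - M) / #|T|) ^ 2] by [card_hit2]. Since [M] bounds the number of labels revealed in total,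
    the same factor serves at every step. *)
Lemma card_missing X Y d l M : uniq (unpair l) -> (size l).*2 <= M ->
    d <= #|X| -> d <= #|Y| ->
  #|missing X Y l| * (#|T| ^ 2) ^ size l
    <= (#|T| ^ 2 - (d - M) ^ 2) ^ size l * #|T| `!.
Proof.
move=> + + dX dY; elim: l => [|[u v] l IH] /=.
  by move=> _ _; rewrite muln1 mul1n -card_permT max_card.
rewrite inE negb_or => /and3P[/andP[uv ul] vl ul'] szM.
have {}IH := IH ul' (leq_trans (leqnSn _) (ltnW szM)).
pose Z : {set T} := [set x in unpair l]%SET.
have cZ : #|Z| = (size l).*2.
  by rewrite cardsE (card_uniqP ul') size_unpair.
have dep : depends_on (missing X Y l) Z.
  move=> w w'; rewrite !inE => /allP wl eqw; apply/allP => p pl.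
  have inZ x : x \in [:: p.1; p.2] -> x \in Z.
    move=> xp; rewrite inE; apply/flattenP.
    by exists [:: p.1; p.2] => //; apply: map_f.
  by rewrite -!eqw ?inZ ?inE ?eqxx ?orbT //; apply: wl.
have := @card_hit2 _ _ X Y d u v dep _ _ uv dX dY.
rewrite !inE => /(_ ul vl); rewrite cZ => h.
have {}h : (d - M) ^ 2 * #|missing X Y l| <= #|T| ^ 2 *
   #|[set w in missing X Y l | (w u \in X) && (w v \in Y)]%SET|.
  apply: leq_trans h; rewrite leq_mul2r leq_sqr leq_sub2l ?orbT //.
  by apply: leq_trans szM.
have e : #|missing X Y ((u, v) :: l)| +
    #|[set w in missing X Y l | (w u \in X) && (w v \in Y)]%SET|
    = #|missing X Y l|.
  rewrite -[RHS](cardsID [set w : {perm T} | (w u \in X) && (w v \in Y)]%SET).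
  rewrite addnC.
  congr (_ + _); apply: eq_card => w; rewrite !inE //=.
have key : #|missing X Y ((u, v) :: l)| * #|T| ^ 2
    <= (#|T| ^ 2 - (d - M) ^ 2) * #|missing X Y l|.
  move: (congr1 (muln (#|T| ^ 2)) e) h; rewrite mulnDr mulnBl [leqLHS]mulnC.
  lia.
rewrite [_ ^ _.+1]expnS mulnA [X in _ <= X * _]expnS.
apply: leq_trans (leq_mul key (leqnn _)) _.
by rewrite -!mulnA leq_mul2l IH orbT.
Qed.
End Switching.

(** * Rerouting paths and closing cycles *)

Section Rerouting.
Variables (T : eqType) (e : rel T).
Hypothesis e_sym : symmetric e.

(** A path from [x] to [y] can be spliced into [B] between [z] and [z']. *)
Definition linked (B : seq T) (x y : T) : Prop :=
  exists B1 z z' B2, [/\ B = B1 ++ z :: z' :: B2, e z x & e y z'].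

(** Only the first [j] vertices of [R] are spliced in, which makes the length adjustable. The splice
    is followed by [z'], so the end of [B] is unchanged and the next block still attaches. *)
Lemma insert_path x0 B R j : (forall x y, linked B x y) ->
    path e x0 B -> sorted e R -> j <= size R ->
  exists B', [/\ path e x0 B', last x0 B' = last x0 B,
                 size B' = size B + j & perm_eq (B' ++ drop j R) (B ++ R)].
Proof.
move=> lB pB sR jR.
case E: (take j R) => [|a R'].
  have j0 : j = 0 by rewrite -(size_takel jR) E.
  by exists B; rewrite j0 drop0 addn0.
have sR' : path e a R' by have := take_sorted j sR; rewrite E.
have [B1 [z [z' [B2 [eB zx yz]]]]] := lB a (last a R').
move: pB; rewrite eB cat_path /= => /and4P[p1 p2 p3 p4].
exists (B1 ++ z :: (a :: R') ++ z' :: B2); split.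
- by rewrite cat_path /= p1 p2 zx cat_path sR' /= yz p4.
- by rewrite !last_cat /= last_cat.
- by have := size_takel jR; rewrite E !(size_cat, size_cat) /= size_cat /=; lia.
rewrite -{2}(cat_take_drop j R) E.
by apply/seq.permP => p; rewrite !(count_cat, count_cat) /= !count_cat /=; lia.
Qed.

Lemma insert_paths x0 Bs L Rs k :
    (forall B, B \in Bs -> forall x y, linked B x y) ->
    path e x0 (flatten Bs ++ L) -> all (sorted e) Rs ->
    size Rs <= size Bs ->
    size (flatten Bs ++ L) <= k <= size (flatten Bs ++ L) + size (flatten Rs) ->
  exists Q r, [/\ path e x0 Q, size Q = k &
                  perm_eq (Q ++ r) (flatten Bs ++ L ++ flatten Rs)].
Proof.
elim: Rs x0 Bs k => [|R Rs IH] x0 Bs k lBs pB aR sz szk.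
  exists (flatten Bs ++ L), [::]; split=> //; last by rewrite /= !cats0.
  by move: szk => /=; lia.
case: Bs lBs pB sz szk => [//|B Bs] lBs.
rewrite [flatten (B :: Bs)]/= [flatten (R :: Rs)]/= -!catA cat_path.
move=> /andP[pB pBs] sz; rewrite !size_cat => szk.
move: aR => /= /andP[sR aR].
(* As much of [R] is inserted as the target length [k] permits; the remaining paths supply the
   rest. *)
pose j := minn (k - (size B + (size (flatten Bs) + size L))) (size R).
have jR : j <= size R by rewrite geq_minr.
have [|B' [pB' lB' sB' permB']] := insert_path (lBs B _) pB sR jR.
  by rewrite mem_head.
have [|//|//|//||Q [r [pQ sQ permQ]]] := IH (last x0 B) Bs (k - size B - j).
- by move=> B2 B2s; apply: lBs; rewrite inE B2s orbT.
- by rewrite !size_cat; move: szk; rewrite /j; lia.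
exists (B' ++ Q), (r ++ drop j R); split.
- by rewrite cat_path pB' lB'.
- by rewrite size_cat sB' sQ /j; lia.
apply/seq.permP => p; move/seq.permP/(_ p): permB'; move/seq.permP/(_ p): permQ.
by rewrite !(count_cat, count_cat); lia.
Qed.

Lemma cycle_cat_path a s b t : path e a s -> path e b t ->
  e (last a s) b -> e (last b t) a -> path.cycle e ((a :: s) ++ b :: t).
Proof.
move=> ps pt ab ba.
by rewrite /= rcons_path last_cat /= ba cat_path ps /= ab pt.
Qed.

(** A rotation: the segment from [z'] to the last vertex [y] is reversed, so that [z] is followed by
    [y] and the cycle closes from [z'] to the first vertex [x]. *)
Lemma rotate_path B Q q0 : (forall x y, linked B x y) ->
    sorted e (B ++ q0 :: Q) ->
  exists2 c, path.cycle e c & perm_eq c (B ++ q0 :: Q).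
Proof.
move=> lB sB; pose y := last q0 Q; pose x := head q0 B.
have [B1 [z [z' [B2 [eB zy xz]]]]] := lB y x.
exists ((B1 ++ [:: z]) ++ rev (z' :: B2 ++ q0 :: Q)); last first.
  rewrite eB; apply/seq.permP => p.
  by rewrite !(count_cat, count_rev, count_cat) /= !count_cat /=; lia.
have /andP[sL sR] : sorted e (B1 ++ [:: z]) && sorted e (z' :: B2 ++ q0 :: Q).
  move: sB; rewrite eB -catA /= -[z :: _]cat1s catA => sB.
  by apply/andP; case: (cat_sorted2 sB).
have {}sR : sorted e (rev (z' :: B2 ++ q0 :: Q)).
  by rewrite rev_sorted (eq_sorted (e' := e)) // => ? ?; rewrite e_sym.
have hL : head q0 (B1 ++ [:: z]) = x by rewrite /x eB; case: (B1).
have lL : last q0 (B1 ++ [:: z]) = z by rewrite last_cat.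
have hR : head q0 (rev (z' :: B2 ++ q0 :: Q)) = y.
  rewrite -cat_cons lastI -cat_rcons rev_cat /y.
  by case: (lastP Q) => [|Q' q] //=; rewrite -?rcons_cons ?rev_rcons ?last_rcons.
have lR : last q0 (rev (z' :: B2 ++ q0 :: Q)) = z'.
  by rewrite rev_cons last_rcons.
move: sL hL lL sR hR lR.
case: (B1 ++ [:: z]) (size_cat B1 [:: z]) => [|a s] /=; first by rewrite addn1.
case: (rev _) (size_rev (z' :: B2 ++ q0 :: Q)) => [//|b t] _ _ /=.
move=> ps ax lz pt bY tz; subst a b.
by apply: cycle_cat_path => //; rewrite ?lz ?tz // e_sym.
Qed.

Lemma cycles_of_linked B0 Bs L Rs :
    sorted e (B0 ++ flatten Bs ++ L) -> all (sorted e) Rs ->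
    size Rs <= size Bs ->
    (forall B, B \in B0 :: Bs -> forall x y, linked B x y) ->
    uniq (B0 ++ flatten Bs ++ L ++ flatten Rs) ->
    size B0 <= size (flatten Bs ++ L) ->
  forall k, 3 <= k <= size (B0 ++ flatten Bs ++ L ++ flatten Rs) ->
  exists2 c, size c = k & ucycle e c.
Proof.
move=> sW sRs szR lk uW szB0 k /andP[k3 kn].
have lB0 : forall x y, linked B0 x y by apply: lk; rewrite mem_head.
set F := flatten Bs ++ L in sW szB0.
have [sB0 sF] := cat_sorted2 sW.
have szW : k <= size B0 + (size F + size (flatten Rs)).
  by move: kn; rewrite !size_cat; lia.
(* For small [k], a path of [k - 2] vertices of [F] is closed through one edge of [B0]; it exists
   because [F] is at least as long as [B0]. For larger [k], [B0] is extended to a path of [k]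
   vertices and rotated. *)
have [kB0|kB0] := leqP k (size B0 + 2).
  case EP : (take (k - 2) F) => [|p P].
    by have := size_take_min (k - 2) F; rewrite EP /=; lia.
  have szP : (size P).+1 = k - 2.
    by rewrite -[LHS]/(size (p :: P)) -EP size_take_min; lia.
  have [B1 [z [z' [B2 [eB zx yz]]]]] := lB0 p (last p P).
  exists [:: z', z, p & P]; first by rewrite /=; lia.
  apply/andP; split.
    rewrite /= rcons_path zx yz !andbT.
    move: (take_sorted (k - 2) sF); rewrite EP /= => ->; rewrite andbT.
    by move: sB0; rewrite eB => /cat_sorted2[_] /= /andP[]; rewrite e_sym.
  have : uniq ([:: z; z'] ++ (p :: P)).
    apply: subseq_uniq uW; rewrite eB -EP.
    have -> : flatten Bs ++ L ++ flatten Rs = F ++ flatten Rs.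
      by rewrite /F -catA.
    rewrite cat_subseq //; last first.
      exact: subseq_trans (take_subseq _ _) (prefix_subseq _ _).
    exact: subseq_trans (prefix_subseq [:: z; z'] B2) (suffix_subseq B1 _).
  by rewrite (perm_uniq (_ : perm_eq _ [:: z', z, p & P])) //
    (perm_catCA [:: z] [:: z']).
have [x0 _] : exists x : T, true.
  by case: (B0 ++ _) kn => [|x s _]; [rewrite /=; lia | exists x].
have [b [B eB]] : exists b B, B0 = b :: B.
  by have [[|b B] [z [z' [B2 [-> _ _]]]]] := lB0 x0 x0; eexists; eexists.
have [Q [r [q0 [Q' [eQ pQ sQ permQ]]]]] : exists Q r q0 Q', [/\ Q = q0 :: Q',
    sorted e (B0 ++ Q), size Q = k - size B0 &
    perm_eq (Q ++ r) (F ++ flatten Rs)].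
  have [Q [r [pQ sQ permQ]]] : exists Q r, [/\ sorted e (B0 ++ Q),
      size Q = k - size B0 & perm_eq (Q ++ r) (F ++ flatten Rs)].
    have [kF|kF] := leqP (k - size B0) (size F).
      exists (take (k - size B0) F), (drop (k - size B0) F ++ flatten Rs).
      rewrite catA cat_take_drop size_takel //; split=> //.
      move: sW; rewrite -{1}(cat_take_drop (k - size B0) F) catA.
      by case/cat_sorted2.
    have [|||||Q [r [pQ sQ permQ]]] :=
      @insert_paths (last b B) Bs L Rs (k - size B0).
    - by move=> B' B's; apply: lk; rewrite inE B's orbT.
    - by move: sW; rewrite eB /= cat_path => /andP[].
    - by [].
    - by [].
    - by rewrite -/F; lia.
    exists Q, r; split=> //; last by rewrite /F -catA.
    by rewrite eB /= cat_path pQ andbT; move: sB0; rewrite eB.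
  case: Q pQ sQ permQ => [|q0 Q'] pQ sQ permQ; first by move: sQ => /=; lia.
  by exists (q0 :: Q'), r, q0, Q'.
have [|c cy permc] := @rotate_path B0 Q' q0 lB0; first by rewrite -eQ.
exists c.
  by rewrite (perm_size permc) -eQ size_cat sQ; lia.
rewrite /ucycle cy (perm_uniq permc) -eQ.
have : uniq (B0 ++ Q ++ r).
  by rewrite (perm_uniq (_ : perm_eq _ (B0 ++ F ++ flatten Rs))) ?perm_cat2l //
    /F -catA.
by rewrite catA cat_uniq => /and3P[].
Qed.
End Rerouting.

(** * Graphs and relabelings *)

Section Graphs.
Variable n : nat.
Implicit Types (G : sgraph n) (w : {perm 'I_n}).

Lemma adj_sym G : symmetric (adj G).
Proof. by move=> x y; rewrite /adj finset.setUC. Qed.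

Lemma edge_card G e : e \in edges G -> #|e| = 2.
Proof. by move=> eG; apply/eqP/(forall_inP (edgesP G)). Qed.

Lemma adj_irr G : irreflexive (adj G).
Proof.
by move=> x; apply/negP => /edge_card; rewrite finset.setUid cards1.
Qed.

Lemma sgraph_ext G G' : adj G =2 adj G' -> G = G'.
Proof.
move=> eqA; apply/val_inj/setP => e /=; apply/idP/idP => eG.
  have /eqP/cards2P[x [y [_ exy]]] := edge_card eG.
  by move: eG; rewrite exy -!/(adj _ x y) eqA.
have /eqP/cards2P[x [y [_ exy]]] := edge_card eG.
by move: eG; rewrite exy -!/(adj _ x y) eqA.
Qed.

Lemma degree_nbrs G v : degree G v = #|[set y | adj G v y]%SET|.
Proof.
rewrite /degree -(card_in_imset (f := fun y => [set v; y]%SET)).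
  apply: eq_card => e; rewrite inE; apply/andP/imsetP => [[eG ve]|[y]].
    have /eqP/cards2P[a [b [ab exy]]] := edge_card eG.
    move: eG ve; rewrite exy !inE => eG /orP[] /eqP ->.
      by exists b; rewrite // inE.
    by exists a; [rewrite inE adj_sym | rewrite finset.setUC].
  by rewrite inE => vy ->; split; rewrite ?inE ?eqxx //; apply: vy.
move=> y y'; rewrite !inE => vy vy' /setP/(_ y); rewrite !inE eqxx orbT.
case: eqP => [yv|_] /esym/eqP //.
by move: vy; rewrite yv adj_irr.
Qed.

Lemma regular2_nbrs G : gregular 2 G ->
  forall v, exists a b, a != b /\ adj G v =1 pred2 a b.
Proof.
move=> /forallP G2 v; move: (G2 v); rewrite degree_nbrs.
move=> /cards2P[a [b [ab eab]]]; exists a, b; split=> // z.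
by have /setP/(_ z) := eab; rewrite !inE.
Qed.

Lemma min_degree_le G v : min_degree G <= degree G v.
Proof.
rewrite /min_degree; elim: (index_enum _) (mem_index_enum v) => // u r IH.
rewrite inE big_cons geq_min => /orP[/eqP <-|vr]; first by rewrite leqnn.
by rewrite IH ?orbT.
Qed.

Lemma relabel_subproof w G :
  simple_edges [set [set w x | x in e]%SET | e : {set 'I_n} in edges G]%SET.
Proof.
apply/forall_inP => e /imsetP[e' eG ->].
by rewrite card_imset ?(edge_card eG) //; apply: perm_inj.
Qed.

Definition relabel w G : sgraph n := SGraph (relabel_subproof w G).

Lemma adj_relabel w G x y : adj (relabel w G) (w x) (w y) = adj G x y.
Proof.
rewrite /adj /=.
have -> : [set w x; w y]%SET = (w @: [set x; y])%SET.
  by rewrite imsetU1 imset_set1.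
by rewrite (mem_imset _ _ (imset_inj perm_inj)).
Qed.

Lemma relabelK w G : relabel w (relabel w^-1 G) = G.
Proof.
apply: sgraph_ext => x y.
rewrite -[x in LHS](permKV w) -[y in LHS](permKV w) adj_relabel.
exact: adj_relabel.
Qed.

Lemma gregular_relabel d w G : gregular d (relabel w G) = gregular d G.
Proof.
have deg x : degree (relabel w G) (w x) = degree G x.
  rewrite !degree_nbrs -[RHS](card_imset _ (@perm_inj _ w)).
  apply: eq_card => y; rewrite -[y](permKV w) (mem_imset _ _ perm_inj).
  by rewrite !inE adj_relabel.
apply/forallP/forallP => dG x; first by rewrite -deg.
by rewrite -[x](permKV w) deg.
Qed.

(** For a fixed [w], relabeling permutes the regular graphs, so after exchanging sums each of the
    [n!] permutations accounts for every graph satisfying [A]. *)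
Lemma card_relabel_avg d (A : pred (sgraph n)) :
  #|[set G in regular_graphs n d | A G]%SET| * n`!
    <= \sum_(G in regular_graphs n d) #|[set w | A (relabel w G)]%SET|.
Proof.
have -> : n`! = #|{: {perm 'I_n}}| by rewrite card_permT card_ord.
under eq_bigr do rewrite -sum1_card.
under eq_bigr do under eq_bigl do rewrite inE.
rewrite (exchange_big_dep predT) //= mulnC -sum_nat_const.
apply: leq_sum => w _; rewrite sum1_card.
rewrite -[leqLHS](card_imset _ (can_inj (relabelK w))).
apply/subset_leq_card/fintype.subsetP => G /imsetP[G'].
rewrite !inE => /andP[rG AG] ->.
by rewrite unfold_in /= relabelK AG inE gregular_relabel rG.
Qed.

End Graphs.

(** * The Hamilton cycle and a lower bound on the number of 2-regular graphs *)

Section HamiltonCycle.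
Variable N : nat.
Local Notation n := N.+3.

Lemma ordSE (x : 'I_n) : val (ordS x) = if val x == N.+2 then 0 else x.+1.
Proof.
rewrite /=; case: eqP => [->|xN]; first by rewrite modnn.
by rewrite modn_small //; have := ltn_ord x; move: xN => /=; lia.
Qed.

Lemma ord_predE (x : 'I_n) :
  val (ord_pred x) = if val x == 0 then N.+2 else x.-1.
Proof.
have := ordSE (ord_pred x); rewrite ord_predK.
have := ltn_ord (ord_pred x); move: (ord_pred x) => y /= yn ->.
by case: (@eqP _ (y : nat) N.+2).
Qed.

Lemma ordS_neq (x : 'I_n) : x != ordS x.
Proof. by rewrite -val_eqE ordSE /=; case: ifP; lia. Qed.

Lemma cycle_graph_subproof :
  simple_edges [set [set x; ordS x]%SET | x : 'I_n]%SET.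
Proof.
apply/forall_inP => e /imsetP[x _ ->]; rewrite cards2.
by rewrite ordS_neq.
Qed.

Definition cycle_graph : sgraph n := SGraph cycle_graph_subproof.

Lemma adj_cycle_graph x y :
  adj cycle_graph x y = (y == ordS x) || (y == ord_pred x).
Proof.
apply/imsetP/orP => [[z _ ez]|[] /eqP ->]; last 2 first.
- by exists x.
- by exists (ord_pred x); rewrite // finset.setUC ord_predK.
have xy : x != y.
  apply: contraTneq (ordS_neq z) => exy; rewrite exy finset.setUid in ez.
  have /set1P hz : z \in [set y]%SET by rewrite ez !inE eqxx.
  have /set1P hS : ordS z \in [set y]%SET by rewrite ez !inE eqxx orbT.
  by rewrite hS hz eqxx.
have : x \in [set z; ordS z]%SET by rewrite -ez !inE eqxx.
have : y \in [set z; ordS z]%SET by rewrite -ez !inE eqxx orbT.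
rewrite !inE => /orP[]/eqP yz /orP[]/eqP xz; subst x y;
  rewrite ?eqxx // in xy *.
- by right; rewrite ordSK.
- by left.
Qed.

Lemma cycle_graph_regular : gregular 2 cycle_graph.
Proof.
apply/forallP => x; rewrite degree_nbrs.
rewrite (_ : [set y | _]%SET = [set ordS x; ord_pred x]%SET); last first.
  by apply/setP => y; rewrite !inE adj_cycle_graph.
rewrite cards2; suff -> : ordS x != ord_pred x by [].
by rewrite -val_eqE ordSE ord_predE /=; case: ifP; case: ifP; lia.
Qed.

(** Once two consecutive vertices are fixed, the next one must go to the other neighbour of the
    second, so [u] is determined around the cycle. *)
Lemma cycle_graph_rigid (u : {perm 'I_n}) :
    (forall x y, adj cycle_graph (u x) (u y) = adj cycle_graph x y) ->
  u ord0 = ord0 -> u (inord 1) = inord 1 -> u = 1%g.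
Proof.
move=> uA u0 u1; apply/permP => x; rewrite perm1.
suff H i : i < N.+2 ->
    u (inord i) = inord i /\ u (inord i.+1) = inord i.+1 :> 'I_n.
  have := ltn_ord x; case E : (val x) => [|i] xn.
    by have -> : x = ord0 by apply: val_inj.
  have -> : x = inord i.+1 by apply: val_inj; rewrite /= inordK.
  by case: (H i xn).
elim: i => [|i IH] iN.
  rewrite u1; split=> //; suff -> : inord 0 = ord0 :> 'I_n by [].
  by apply: val_inj; rewrite /= inordK.
have [ui ui1] := IH (ltnW iN); split=> //.
have i1 : i.+1 < n by lia.
have i0 : i < n by lia.
have : adj cycle_graph (inord i.+1) (inord i.+2).
  rewrite adj_cycle_graph; apply/orP; left.
  by rewrite -val_eqE ordSE /= !inordK //; case: ifP; lia.
rewrite -uA ui1 adj_cycle_graph => /orP[] /eqP E.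
  by rewrite E; apply: val_inj; rewrite ordSE /= !inordK //; case: ifP; lia.
have E' : u (inord i.+2) = u (inord i).
  by rewrite E ui; apply: val_inj; rewrite ord_predE /= !inordK //; lia.
by have /(congr1 val) := perm_inj E'; rewrite /= !inordK //; lia.
Qed.

End HamiltonCycle.

(** By rigidity, a relabeled Hamilton cycle together with the images of vertices 0 and 1 determines
    the relabeling. *)
Lemma card_regular2 n : 2 < n -> n`! <= #|regular_graphs n 2| * n ^ 2.
Proof.
case: n => [|[|[|N]]] // _; set n := N.+3.
pose f (w : {perm 'I_n}) := (relabel w (cycle_graph N), (w ord0, w (inord 1))).
have f_inj : injective f.
  move=> w w' [eG e0 e1].
  suff : (w * w'^-1)%g = 1%g by move/eqP; rewrite -eq_mulgV1 => /eqP.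
  apply: cycle_graph_rigid; rewrite ?permM ?e0 ?e1 ?permK //.
  move=> x y; rewrite !permM -[RHS](adj_relabel w).
  have -> : relabel w (cycle_graph N) = relabel w' (cycle_graph N).
    by apply: val_inj.
  by rewrite -[in RHS](permKV w' (w x)) -[in RHS](permKV w' (w y)) adj_relabel.
have -> : n`! = #|[set f w | w : {perm 'I_n}]%SET|.
  by rewrite (card_imset _ f_inj) card_permT card_ord.
have -> : #|regular_graphs n 2| * n ^ 2
    = #|finset.setX (regular_graphs n 2)
          (finset.setX [set: 'I_n]%SET [set: 'I_n]%SET)|.
  by rewrite !cardsX cardsT card_ord.
apply/subset_leq_card/fintype.subsetP => _ /imsetP[w _ ->].
by rewrite !inE gregular_relabel cycle_graph_regular.
Qed.

(* Injectivity of the orientation [G |-> s] transfers the count of permutations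
   with many cycles to 2-regular graphs. *)
Lemma card_many_cycles n t (A : pred (sgraph n)) :
    (forall G (s : {perm 'I_n}), A G ->
       (forall x y, adj G x y = (s x == y) || (s y == x)) ->
       t <= #|porbits s|) ->
  #|[set G in regular_graphs n 2 | A G]%SET| * 2 ^ t <= n.+1 `!.
Proof.
move=> At; have := card_many_porbits 'I_n t; rewrite card_ord.
apply: leq_trans; rewrite leq_mul2r; apply/orP; right.
pose orients (G : sgraph n) (s : {perm 'I_n}) :=
  [forall x, forall y, adj G x y == ((s x == y) || (s y == x))].
have orientsP G (s : {perm 'I_n}) :
    reflect (forall x y, adj G x y = (s x == y) || (s y == x)) (orients G s).
  by apply: (iffP forallP) => h x; [move=> y; apply/eqP; move/forallP: (h x)
    | apply/forallP => y; rewrite h].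
pose f G := odflt 1%g [pick s | orients G s].
have fP G : gregular 2 G -> orients G (f G).
  move=> G2; rewrite /f; case: pickP => // none.
  have [s hs] := orientation (adj_sym G) (adj_irr G) (regular2_nbrs G2).
  by have /orientsP := none s.
rewrite -(card_in_imset (f := f)).
  apply/subset_leq_card/fintype.subsetP => _ /imsetP[G + ->].
  rewrite !inE => /andP[G2 AG]; apply: At AG _.
  exact/orientsP/fP.
move=> G G'; rewrite !inE => /andP[G2 _] /andP[G2' _] eqf.
apply: sgraph_ext => x y; move/orientsP: (fP _ G2) => ->.
by rewrite eqf; move/orientsP: (fP _ G2') => ->.
Qed.

(** * Relabelings of a graph with few cycles *)

Lemma union_bound (I T : finType) (B : {set T}) (F : I -> {set T}) :
  (forall x, x \in B -> exists i, x \in F i) -> #|B| <= \sum_i #|F i|.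
Proof.
move=> BF; under eq_bigr do rewrite -sum1_card big_mkcond.
rewrite exchange_big /= -sum1_card big_mkcond; apply: leq_sum => x _.
case: ifP => // /BF[i xi]; rewrite (bigD1 i) //= xi; exact: leq_addr.
Qed.

Lemma has_long (T : eqType) (ps : seq (seq T)) t K :
    size ps <= t -> t * K <= size (flatten ps) -> 0 < size (flatten ps) ->
  exists2 p, p \in ps & K <= size p.
Proof.
move=> pst tK ps0; apply/hasP; apply: contraLR tK.
rewrite -all_predC => /allP short; rewrite -ltnNge.
apply: leq_trans (_ : (size ps * K.-1).+1 <= _).
  rewrite ltnS; elim: ps short {pst ps0} => //= p ps IH short.
  rewrite size_cat mulSn leq_add //.
    by have := short p (mem_head _ _); rewrite /= -ltnNge; case: (K).
  by apply: IH => q qs; apply: short; rewrite inE qs orbT.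
case: ps ps0 pst short => //= p ps _ pst /(_ p (mem_head _ _)) /=.
rewrite -ltnNge => pK; nia.
Qed.

Lemma unpair_split (T : finType) m (p : seq T) : m.*2 <= size p ->
  exists l L, size l = m /\ p = unpair l ++ L.
Proof.
elim: m p => [|m IH] p; first by exists [::], p.
case: p => [|x [|y p]] //= sz.
have [|l [L [sl ->]]] := IH p; first by move: sz; lia.
by exists ((x, y) :: l), L; rewrite /= sl.
Qed.

Lemma block_split (T : finType) m k (p : seq T) : k * m.*2 <= size p ->
  exists ls L, [/\ size ls = k, all (fun l => size l == m) ls &
                   p = flatten (map (@unpair T) ls) ++ L].
Proof.
elim: k p => [|k IH] p sz; first by exists [::], p.
have [|l [L [sl ep]]] := @unpair_split T m p; first by move: sz; nia.
have [|ls [L' [sls als eL]]] := IH L.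
  by move: sz; rewrite ep size_cat size_unpair sl; lia.
by exists (l :: ls), L'; rewrite /= sls als sl eqxx ep eL catA.
Qed.

Lemma gunionE n (H G : sgraph n) x y :
  adj (gunion H G) x y = adj H x y || adj G x y.
Proof. by rewrite /adj /= inE. Qed.

Lemma pancyclicP n (G : sgraph n) :
  (forall k, 3 <= k <= n -> exists2 c, size c = k & ucycle (adj G) c) ->
  pancyclic G.
Proof.
move=> cyc; apply/forallP => k; apply/implyP => k3.
have [|c sc uc] := cyc k; first by rewrite k3 -ltnS ltn_ord.
by apply/existsP; exists (Tuple (introT eqP sc)).
Qed.

Section Relabelings.
Variables (n : nat) (H G : sgraph n) (s : {perm 'I_n}) (t m : nat).
Hypothesis adjG : forall x, adj G x (s x).
Hypothesis few : #|porbits s| <= t.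
Hypothesis t0 : 0 < t.
Hypothesis n0 : 0 < n.
Hypothesis m_n : t * (t.+1 * m.*2) <= n.

Let nbrs x : {set 'I_n} := [set y | adj H x y]%SET.

(** The blocks are cut from a long path of [G] before [w] is chosen, so [card_missing] applies to
    them. One block serves for closing the cycle; the [t] others suffice for the at most [t - 1]
    remaining paths. *)
Lemma few_cycles_blocks : exists ls : seq (seq ('I_n * 'I_n)),
  [/\ size ls = t.+1, all (fun l => size l == m) ls,
      uniq (flatten (map (@unpair _) ls)) &
  forall w : {perm 'I_n},
    (forall l x y, l \in ls -> w \notin missing (nbrs x) (nbrs y) l) ->
    pancyclic (gunion H (relabel w G))].
Proof.
have [ps [sps sortps ups szps]] := orbit_forest s.
rewrite card_ord in szps.
have [|||p pps Kp] := @has_long _ ps t (t.+1 * m.*2); rewrite ?szps //.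
  exact: leq_trans few.
have [ls [L [sls als ep]]] := block_split Kp.
have permps : perm_eq ps (p :: rem p ps) := perm_to_rem pps.
have permf : perm_eq (flatten ps) (p ++ flatten (rem p ps)).
  exact: perm_flatten permps.
move: (ups); rewrite (perm_uniq permf) => upps.
exists ls; split=> //.
  by move: upps; rewrite ep -catA cat_uniq => /andP[].
move=> w hit.
pose e := adj (gunion H (relabel w G)).
have linked_l l x y : l \in ls -> linked e (map w (unpair l)) x y.
  move=> lls; have := hit l x y lls.
  rewrite inE -has_predC => /hasP[[u v] uvl] /=.
  rewrite negbK !inE => /andP[xu yv].
  case/splitPr: uvl => [l1 l2].
  exists (map w (unpair l1)), (w u), (w v), (map w (unpair l2)); split.
  - by rewrite /unpair map_cat flatten_cat map_cat.
  - by rewrite /e gunionE adj_sym xu.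
  - by rewrite /e gunionE yv.
have sorted_e q : sorted (frel s) q -> sorted e (map w q).
  rewrite sorted_map; apply: sub_sorted => x y /= /eqP <-.
  by rewrite /relpre /= /e gunionE adj_relabel adjG orbT.
have /allP sps' := sortps.
case: ls => [//|l0 ls] in sls als ep hit linked_l *.
move: sls => [sls].
apply: pancyclicP => k kn.
pose f l := map w (unpair l).
have flatE : f l0 ++ flatten (map f ls) ++ map w L ++
    flatten (map (map w) (rem p ps)) = map w (p ++ flatten (rem p ps)).
  move: (rem p ps) => rs; rewrite map_cat ep /= !map_cat (map_flatten _ rs).
  by rewrite (map_flatten _ (map _ ls)) -map_comp -!catA.
have := @cycles_of_linked _ e (adj_sym _) (f l0) (map f ls) (map w L)
  (map (map w) (rem p ps)).
rewrite flatE; apply.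
- have -> : f l0 ++ flatten (map f ls) ++ map w L = map w p.
    by rewrite ep /= !map_cat (map_flatten _ (map _ ls)) -map_comp -catA.
  by apply: sorted_e; apply: sps'.
- apply/allP => _ /mapP[q qps ->]; apply: sorted_e; apply: sps'.
  exact: mem_rem qps.
- rewrite !size_map sls size_rem //; apply: leq_trans (leq_pred _) _.
  exact: leq_trans sps few.
- move=> B; rewrite inE => /orP[/eqP ->|/mapP[l lls ->]] x y.
    by apply: linked_l; rewrite mem_head.
  by apply: linked_l; rewrite inE lls orbT.
- by rewrite (map_inj_uniq perm_inj).
- rewrite size_cat; apply: leq_trans (leq_addr _ _).
  (* Since [t] is positive there is a second block, as long as the first. *)
  case: ls als sls {ep hit linked_l flatE} => [|l1 ls] /=; first by lia.
  case/and3P=> /eqP l0m /eqP l1m _ _.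
  by rewrite size_cat !size_map !size_unpair l0m l1m leq_addr.
- by rewrite size_map -(perm_size permf) szps.
Qed.

(** Union bound over the [t.+1] blocks and the [n ^ 2] pairs [(x, y)], each event having proportion
    at most [2 ^ - t]. *)
Lemma card_bad_relabelings :
    let d := min_degree H in
    (n ^ 2 - (d - m.*2) ^ 2) ^ m * 2 ^ t <= (n ^ 2) ^ m ->
  #|[set w | ~~ pancyclic (gunion H (relabel w G))]%SET| * 2 ^ t
    <= t.+1 * n ^ 2 * n`!.
Proof.
move=> d small; have [ls [sls als uls pan]] := few_cycles_blocks.
pose l_ (i : 'I_t.+1) := nth [::] ls i.
pose F (i : 'I_t.+1 * ('I_n * 'I_n)) :=
  missing (nbrs i.2.1) (nbrs i.2.2) (l_ i.1).
have lls i : l_ i \in ls by rewrite mem_nth // sls.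
have bound i : #|F i| * 2 ^ t <= n`!.
  have ul : uniq (unpair (l_ i.1)).
    case/splitPr: (lls i.1) uls => [l1 l2] uls.
    by move: uls; rewrite map_cat flatten_cat cat_uniq /= cat_uniq => /and4P[].
  have nb x : d <= #|nbrs x| by rewrite -degree_nbrs min_degree_le.
  have sl : size (l_ i.1) = m by apply/eqP/(allP als).
  have := @card_missing _ (nbrs i.2.1) (nbrs i.2.2) d (l_ i.1) m.*2 ul.
  rewrite sl leqnn card_ord => /(_ erefl (nb _) (nb _)) h.
  rewrite -(leq_pmul2r (m := (n ^ 2) ^ m)) ?expn_gt0 ?n0 //.
  rewrite mulnAC; apply: leq_trans (leq_mul h (leqnn _)) _.
  by rewrite mulnAC [leqRHS]mulnC leq_mul2r small orbT.
have cov w : w \in [set w | ~~ pancyclic (gunion H (relabel w G))]%SET ->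
    exists i, w \in F i.
  rewrite inE => np; apply/existsP; apply: contraNT np => /existsPn none.
  apply: pan => l x y lin.
  have il : index l ls < t.+1 by rewrite -sls index_mem.
  by have := none (Ordinal il, (x, y)); rewrite /F /l_ /= nth_index.
apply: leq_trans (leq_mul (union_bound cov) (leqnn _)) _.
rewrite big_distrl /=; apply: leq_trans (leq_sum _ (fun i _ => bound i)) _.
by rewrite sum_nat_const !card_prod !card_ord leqnn.
Qed.

End Relabelings.

(** * Choice of the parameters *)

(** Bernoulli's inequality: [(1 + b / c) ^ M >= 1 + M b / c >= 2]. *)
Lemma double_expn_le c b M : 0 < M -> c <= M * b -> c ^ M * 2 <= (c + b) ^ M.
Proof.
move=> M0 cMb; case: (posnP c) => [->|c0]; first by rewrite exp0n.
have bern k : c ^ k * (c + k * b) <= (c + b) ^ k * c.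
  elim: k => [|k IH]; first by rewrite mul0n addn0.
  apply: leq_trans (_ : c ^ k * (c + k * b) * (c + b) <= _).
    by rewrite !expnS; move: (c ^ k) => x; nia.
  by rewrite expnS -[leqRHS]mulnA [leqRHS]mulnC leq_mul2r IH orbT.
rewrite -(leq_pmul2r c0); apply: leq_trans (bern M).
by rewrite -mulnA leq_mul2l; apply/orP; right; lia.
Qed.

Lemma expn_le_exp2 D : exists T0, forall t, T0 <= t -> t.+1 ^ D <= 2 ^ t.
Proof.
case: (posnP D) => [->|D0]; first by exists 0 => t _; rewrite expn_gt0.
(* With [s] the quotient of [t] by [2 D], this threshold gives [t + 1 <= (s + 1) ^ 2], and
   [s + 1 <= 2 ^ s] finishes. *)
exists ((2 * D) ^ 2) => t tT.
pose s := t %/ (2 * D).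
have ts : t < s.+1 * (2 * D) by rewrite ltn_ceil // muln_gt0.
have sD : 2 * D <= s.+1.
  rewrite leqNgt; apply/negP => sD.
  by move: tT; rewrite leqNgt (leq_trans ts) // leq_mul2r orbC ltnW.
apply: leq_trans (_ : (s.+1 ^ 2) ^ D <= _).
  rewrite leq_exp2r //; apply: leq_trans ts _.
  by rewrite leq_mul2l sD orbT.
rewrite -expnM; apply: leq_trans (_ : (2 ^ s) ^ (2 * D) <= _).
  by rewrite leq_exp2r ?muln_gt0 //; apply: ltn_expl.
by rewrite -expnM leq_exp2l //; apply: leq_trunc_div.
Qed.

Section Numerics.
Variables (n t d : nat).
Hypotheses (t256 : 256 <= t) (tn : t ^ 8 <= n) (nt : n < t.+1 ^ 8).
Hypothesis nd : n ^ 3 <= d ^ 4.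

(** [M] pairs halve the failure probability: with [D >= d / 2], [(n / D) ^ 2] is at most
    [4 n ^ (1/2)], hence at most [M]. Then [t] such groups bring it down to [2 ^ - t]. *)
Let M := 4 * t.+1 ^ 4.
Let m := M * t.

Let Mt : M <= 64 * t ^ 4.
Proof.
rewrite /M (_ : 64 = 4 * 2 ^ 4) // -mulnA leq_mul2l /= -expnMn.
by rewrite leq_exp2r //; lia.
Qed.

(** Ensures that the [2 m] labels revealed in a block use up at most half of [d]; it reduces to
    [256 t ^ 5 <= t ^ 6 <= d]. *)
Lemma block_le_degree : 4 * m <= d.
Proof.
rewrite -(leq_exp2r _ _ (e := 4)) //; apply: leq_trans nd.
apply: leq_trans (_ : (t ^ 8) ^ 3 <= _); last by rewrite leq_exp2r.
rewrite -expnM (_ : 8 * 3 = 6 * 4) // expnM leq_exp2r // /m.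
apply: leq_trans (_ : 4 * (64 * t ^ 4 * t) <= _).
  by rewrite !leq_mul2l leq_mul2r Mt !orbT.
have -> : 4 * (64 * t ^ 4 * t) = 256 * t ^ 5.
  by rewrite (expnS t 4); move: (t ^ 4) => x; lia.
by rewrite (expnS t 5) leq_mul2r t256 orbT.
Qed.

Lemma blocks_fit : t * (t.+1 * m.*2) <= n.
Proof.
apply: leq_trans tn; rewrite /m -muln2.
apply: leq_trans (_ : t * ((2 * t) * (64 * t ^ 4 * t * 2)) <= _).
  apply: leq_mul => //; apply: leq_mul; first by lia.
  by rewrite !leq_mul2r Mt !orbT.
rewrite (_ : 8 = 1 + 7) // expnD expn1 leq_mul2l; apply/orP; right.
have -> : 2 * t * (64 * t ^ 4 * t * 2) = 256 * t ^ 6.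
  by rewrite (expnD t 4 2) -mulnn; move: (t ^ 4) => x; lia.
by rewrite (expnS t 6) leq_mul2r t256 orbT.
Qed.

Lemma miss_prob_small :
  (n ^ 2 - (d - m.*2) ^ 2) ^ m * 2 ^ t <= (n ^ 2) ^ m.
Proof.
set D := d - m.*2.
have dD : d <= 2 * D by have := block_le_degree; rewrite /D; lia.
have MD : n ^ 2 <= M * D ^ 2.
  apply: leq_trans (_ : t.+1 ^ 4 * d ^ 2 <= _).
    rewrite -leq_sqr -expnM expnMn -!expnM (_ : 2 * 2 = 1 + 3) // expnD expn1.
    by apply: leq_mul; first exact: ltnW.
  rewrite /M mulnAC [leqRHS]mulnC leq_mul2l (_ : 4 = 2 ^ 2) // -expnMn.
  by rewrite leq_sqr dD orbT.
have M0 : 0 < M by rewrite muln_gt0 expn_gt0.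
have : (n ^ 2 - D ^ 2) ^ M * 2 <= (n ^ 2) ^ M.
  have [Dn|Dn] := leqP (D ^ 2) (n ^ 2).
    rewrite -[in leqRHS](subnK Dn); apply: double_expn_le => //.
    exact: leq_trans (leq_subr _ _) MD.
  have /eqP -> : n ^ 2 - D ^ 2 == 0 by rewrite subn_eq0 ltnW.
  by rewrite exp0n.
rewrite /m !(expnM _ M t) -expnMn => h.
by rewrite leq_exp2r //; lia.
Qed.

Lemma total_prob_small :
  t.+1 ^ 26 <= 2 ^ t -> t * (n ^ 2 * (t + n + 2)) <= 2 ^ t.
Proof.
(* The exponents bound the factors [t], [n ^ 2] and [t + n + 2] in turn. *)
apply: leq_trans; rewrite (_ : 26 = 1 + (16 + 9)) // !expnD expn1.
apply: leq_mul => //; apply: leq_mul.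
  by rewrite (expnM _ 8 2) leq_sqr ltnW.
apply: leq_trans (_ : 2 * t.+1 ^ 8 <= _); last first.
  by rewrite [t.+1 ^ 9]expnS leq_mul2r; apply/orP; right; lia.
have : t.+1 <= t.+1 ^ 8 by rewrite -{1}[t.+1]expn1 leq_exp2l //; lia.
lia.
Qed.
End Numerics.

Lemma regular2_gt0 n : 2 < n -> 0 < #|regular_graphs n 2|.
Proof.
move=> /card_regular2; rewrite lt0n; case: eqP => // ->.
by rewrite mul0n leqNgt fact_gt0.
Qed.

(** * The proportion of 2-regular graphs whose union with [H] is not pancyclic *)

Section BadGraphs.
Variables (n t : nat) (H : sgraph n).
Hypotheses (t256 : 256 <= t) (tn : t ^ 8 <= n) (nt : n < t.+1 ^ 8).
Hypothesis nd : n ^ 3 <= (min_degree H) ^ 4.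
Hypothesis t26 : t.+1 ^ 26 <= 2 ^ t.

Let t_le_n : t <= n.
Proof. by apply: leq_trans tn; rewrite -{1}[t]expn1 leq_exp2l //; lia. Qed.

Lemma card_not_pancyclic :
  #|[set G in regular_graphs n 2 | ~~ pancyclic (gunion H G)]%SET| * t
    <= #|regular_graphs n 2|.
Proof.
set bad := #|_|; set reg := #|_|.
pose orients (G : sgraph n) (s : {perm 'I_n}) :=
  [forall x, adj G x (s x)] && (#|porbits s| <= t).
pose many (G : sgraph n) := ~~ [exists s, orients G s].
have manyP : #|[set G in regular_graphs n 2 | many G]%SET| * 2 ^ t <= n.+1`!.
  apply: card_many_cycles => G s /existsPn none adjG.
  have := none s; rewrite negb_and -ltnNge => /orP[/forallPn[x]|/ltnW //].
  by rewrite adjG eqxx.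
have avg := card_relabel_avg 2 (fun G => ~~ pancyclic (gunion H G)).
(* Graphs with many cycles get the trivial bound [n!]; [manyP] makes their total contribution
   small. *)
have each G : G \in regular_graphs n 2 ->
    #|[set w | ~~ pancyclic (gunion H (relabel w G))]%SET| * 2 ^ t
      <= t.+1 * n ^ 2 * n`! + many G * (n`! * 2 ^ t).
  move=> _; rewrite /many; case: existsP => [[s /andP[/forallP adjG few]]|_] /=.
    rewrite mul0n addn0.
    apply: (card_bad_relabelings (m := 4 * t.+1 ^ 4 * t) adjG few).
    - by lia.
    - by lia.
    - exact: blocks_fit t256 tn nt nd.
    - exact: miss_prob_small t256 tn nt nd.
  rewrite mul1n; apply: leq_trans (leq_addl _ _); rewrite leq_mul2r.
  apply/orP; right.
  by rewrite -[in leqRHS](card_ord n) -card_permT max_card.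
have sum_le : bad * n`! * 2 ^ t <= (reg * (t.+1 * n ^ 2) + n.+1`!) * n`!.
  apply: leq_trans (leq_mul avg (leqnn _)) _; rewrite big_distrl /=.
  apply: leq_trans (leq_sum _ each) _.
  rewrite big_split /= sum_nat_const mulnDl mulnA leq_add2l -big_distrl /=.
  rewrite mulnCA mulnC leq_mul2r; apply/orP; right.
  apply: leq_trans manyP; rewrite leq_mul2r; apply/orP; right.
  rewrite -sum1_card big_mkcond [leqRHS]big_mkcond; apply: leq_sum => G _.
  by rewrite inE; case: (G \in _) => //; case: (many G).
(* [card_regular2] replaces [(n + 1)!] by [(n + 1) n ^ 2] times the number of 2-regular graphs. *)
have {}sum_le : bad * 2 ^ t <= reg * (n ^ 2 * (t + n + 2)).
  rewrite -(leq_pmul2r (fact_gt0 n)) mulnAC; apply: leq_trans sum_le _.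
  rewrite leq_mul2r; apply/orP; right.
  have := @card_regular2 n; rewrite factS -/reg => /(_ _) h.
  have {}h : n`! <= reg * n ^ 2 by apply: h; lia.
  have h2 := leq_mul (leqnn n.+1) h.
  by move: h2; move: (n`!) (n ^ 2) => x y; nia.
rewrite -(leq_pmul2r (m := 2 ^ t)) ?expn_gt0 // mulnAC.
apply: leq_trans (leq_mul sum_le (leqnn t)) _.
by rewrite -mulnA leq_mul2l mulnC (total_prob_small t256 tn nt nd t26) orbT.
Qed.
End BadGraphs.

Lemma eighth_root n : exists2 t, t ^ 8 <= n & n < t.+1 ^ 8.
Proof.
elim: n => [|n [t tn nt]]; first by exists 0.
have [h|h] := ltnP n.+1 (t.+1 ^ 8); first by exists t => //; lia.
exists t.+1 => //; apply: leq_trans (_ : (t.+1 ^ 8).+1 <= _); first by lia.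
by rewrite ltn_exp2r.
Qed.

(** * Passage to the limit *)

Local Open Scope classical_set_scope.
Local Open Scope ring_scope.

(** [d ^ 4 >= (a n) ^ 4 >= n ^ 3 ln n >= n ^ 3], the last step because [n] is at least [e]. *)
Lemma degree_pow_ge (R : realType) n d (a : R) :
    expR 1 <= n%:R :> R -> a * n%:R <= d%:R ->
    1 <= a / (ln n%:R / n%:R) `^ (4%:R^-1) ->
  (n ^ 3 <= d ^ 4)%N.
Proof.
move=> en ad a1.
have n0 : 0 < n%:R :> R by apply: lt_le_trans en; apply: expR_gt0.
have ln1 : 1 <= ln n%:R :> R.
  by rewrite -[leLHS](expRK (1 : R)) ler_ln // posrE ?expR_gt0.
have q0 : 0 < ln n%:R / n%:R :> R by rewrite divr_gt0 // (lt_le_trans ltr01).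
set p := _ `^ _ in a1.
have p0 : 0 < p by apply: powR_gt0.
have p4 : p ^+ 4 = ln n%:R / n%:R.
  by rewrite -powR_mulrn ?ltW // -powRrM mulVf // powRr1 // ltW.
have pa : p <= a by move: a1; rewrite ler_pdivlMr // mul1r.
have pd : p * n%:R <= d%:R.
  by apply: le_trans ad; rewrite ler_pM2r.
rewrite -(ler_nat R) !natrX.
apply: le_trans (_ : (p * n%:R) ^+ 4 <= _); last first.
  by rewrite lerXn2r ?nnegrE ?mulr_ge0 // ltW.
rewrite exprMn p4 (exprS _ 3) mulrA divfK ?gt_eqF //.
by rewrite ler_peMl // exprn_ge0 // ltW.
Qed.

Lemma unif_probC (R : realType) (T : finType) (S : {set T}) (A : pred T) :
    (0 < #|S|)%N ->
  1 - unif_prob R S A = unif_prob R S (predC A).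
Proof.
move=> S0; have S0' : #|S|%:R != 0 :> R by rewrite pnatr_eq0 -lt0n.
apply/eqP; rewrite subr_eq /unif_prob -mulrDl -natrD.
suff -> : (#|[set x in S | predC A x]%SET| +
           #|[set x in S | A x]%SET|)%N = #|S|.
  by rewrite divff.
rewrite -[RHS](cardsID [set x | A x]%SET) addnC.
by congr (_ + _)%N; apply: eq_card => x; rewrite !inE // andbC.
Qed.

Theorem theorem1p1 (R : realType) (alpha : nat -> R)
    (H : forall n : nat, sgraph n)
    (halpha : (fun n : nat => alpha n / (ln n%:R / n%:R) `^ (4%:R^-1))
                @ \oo --> +oo)
    (hH : forall n : nat, alpha n * n%:R <= (min_degree (H n))%:R) :
  (fun n : nat => unif_prob R (regular_graphs n 2)
                    (fun G : sgraph n => pancyclic (gunion (H n) G)))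
    @ \oo --> (1 : R).
Proof.
have [T0 hT0] := expn_le_exp2 26.
apply/cvgrPdist_le => eps eps0.
(* The failure probability will be at most [1 / t], so [t >= K] brings it below [eps]. *)
have [K hK] : exists K : nat, eps^-1 <= K%:R.
  by have [K _ /(_ K (leqnn K))] := nbhs_infty_ger eps^-1; exists K.
pose t0 := maxn K (maxn T0 256).
have halpha1 := (cvgryPge _).1 halpha 1.
near=> n.
have tn0 : (t0 ^ 8 <= n)%N by near: n; apply: nbhs_infty_ge.
have n2 : (2 < n)%N by near: n; apply: nbhs_infty_ge.
have en : expR 1 <= n%:R :> R by near: n; apply: nbhs_infty_ger.
have an : 1 <= alpha n / (ln n%:R / n%:R) `^ (4%:R^-1).
  by near: n; exact: halpha1.
have nd := degree_pow_ge en (hH n) an.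
have [t tn nt] := eighth_root n.
have : (t0 <= t)%N.
  by rewrite -ltnS -(ltn_exp2r _ _ (e := 8)) // (leq_ltn_trans tn0).
rewrite !geq_max => /and3P[Kt T0t t256].
have reg0 := regular2_gt0 n2.
have bad := card_not_pancyclic t256 tn nt nd (hT0 _ T0t).
rewrite unif_probC //.
rewrite ger0_norm; last by rewrite divr_ge0.
rewrite /unif_prob ler_pdivrMr ?ltr0n // -ler_pdivrMl //.
have tK : eps^-1 <= t%:R by apply: le_trans hK _; rewrite ler_nat.
apply: le_trans (ler_wpM2r (ler0n _ _) tK) _.
by rewrite mulrC -natrM ler_nat; exact: bad.
Unshelve. all: by end_near.
Qed.
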